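(* The set of indices of computable lattices that are algebraic is $\Pi^1_1$.
   Context: A computable lattice $(L,\preceq)$ has underlying set $L=\omega$ and a computable lattice ordering $\preceq$, formally a computable subset of $\omega^2$. An index of a computable lattice is a number $e$ such that the partial computable function $\varphi_e$ is (total and is) the characteristic function of a lattice ordering $\preceq\subseteq\omega^2$ on $\omega$. A lattice is complete if every subset has both a supremum and an infimum. An element $a\in L$ is compact if for each subset $S\subseteq L$, if $a\preceq\sup S$ then there is a finite subset $S'\subseteq S$ such that $a\preceq\sup S'$. A lattice is compactly generated if every element is the supremum of a set of compact elements, and algebraic if it is complete and compactly generated. A set $C\subseteq\omega$ is $\Pi^1_1$ if it has the form $\{n\in\omega\mid \forall f\in\omega^\omega\ \varphi_e^f(n)\downarrow\}$ for some $e$. *)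

(* Defs.v *)
From Stdlib Require Import Arith Ensembles Finite_sets Relation_Definitions.
From Stdlib Require Cantor.

(** * Oracle computability

    Unary partial recursive functionals; tuples are passed through the Cantor
    pairing bijection of the standard library. *)

Notation "⟨ a , b ⟩" := (Cantor.to_nat (a, b)) (at level 0, format "⟨ a ,  b ⟩").

Inductive code : Set :=
| Zero : code
| Succ : code
| Fst : code
| Snd : code
| Oracle : code
| Pair : code -> code -> code
| Comp : code -> code -> code
| Prec : code -> code -> code
| Mu : code -> code.

(** [eval f c x y]: with oracle [f], program [c] halts on input [x] with
    output [y]. In [eval_Mu] the function [g] only serves to say that [c] halts
    with a nonzero value on every [⟨x, m⟩] with [m < n]. *)
Inductive eval (f : nat -> nat) : code -> nat -> nat -> Prop :=
| eval_Zero x : eval f Zero x 0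
| eval_Succ x : eval f Succ x (S x)
| eval_Fst x : eval f Fst x (fst (Cantor.of_nat x))
| eval_Snd x : eval f Snd x (snd (Cantor.of_nat x))
| eval_Oracle x : eval f Oracle x (f x)
| eval_Pair c d x y z :
    eval f c x y -> eval f d x z -> eval f (Pair c d) x ⟨y, z⟩
| eval_Comp c d x y z :
    eval f d x y -> eval f c y z -> eval f (Comp c d) x z
| eval_Prec_0 c d x y :
    eval f c x y -> eval f (Prec c d) ⟨x, 0⟩ y
| eval_Prec_S c d x n y z :
    eval f (Prec c d) ⟨x, n⟩ y -> eval f d ⟨x, ⟨n, y⟩⟩ z ->
    eval f (Prec c d) ⟨x, S n⟩ z
| eval_Mu c x n (g : nat -> nat) :
    eval f c ⟨x, n⟩ 0 ->
    (forall m, m < n -> eval f c ⟨x, m⟩ (S (g m))) ->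
    eval f (Mu c) x n.

Lemma eval_functional f c x y z : eval f c x y -> eval f c x z -> y = z.
Proof.
  intros H; revert z.
  induction H as [| | | | | c d x y z _ IH1 _ IH2 | c d x y z _ IH1 _ IH2
    | c d x y _ IH | c d x n y z _ IH1 _ IH2 | c x n g _ IH1 _ IH2];
    intros w Hw.
  1-5: inversion Hw; reflexivity.
  - inversion Hw as [| | | | | c' d' x' y' z' H1 H2 | | | |]; subst.
    rewrite (IH1 _ H1), (IH2 _ H2); reflexivity.
  - inversion Hw as [| | | | | | c' d' x' y' z' H1 H2 | | |]; subst.
    rewrite <- (IH1 _ H1) in H2; auto.
  - remember ⟨x, 0⟩ as p eqn:E.
    inversion Hw as [| | | | | | | c' d' x' y' H1 Ec Ep
      | c' d' x' n' y' z' H1 H2 Ec Ep |]; subst p c' d';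
      apply Cantor.to_nat_inj in Ep; inversion Ep; subst; auto.
  - remember ⟨x, S n⟩ as p eqn:E.
    inversion Hw as [| | | | | | | c' d' x' y' H1 Ec Ep
      | c' d' x' n' y' z' H1 H2 Ec Ep |]; subst p c' d';
      apply Cantor.to_nat_inj in Ep; inversion Ep; subst.
    rewrite <- (IH1 _ H1) in H2; auto.
  - inversion Hw as [| | | | | | | | | c' x' n' g' H1 H2]; subst.
    destruct (lt_eq_lt_dec n w) as [[L | L] | L]; auto.
    + discriminate (IH1 _ (H2 n L)).
    + discriminate (IH2 w L _ H1).
Qed.

Fixpoint encode (c : code) : nat :=
  match c with
  | Zero => ⟨0, 0⟩
  | Succ => ⟨1, 0⟩
  | Fst => ⟨2, 0⟩
  | Snd => ⟨3, 0⟩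
  | Oracle => ⟨4, 0⟩
  | Pair c d => ⟨5, ⟨encode c, encode d⟩⟩
  | Comp c d => ⟨6, ⟨encode c, encode d⟩⟩
  | Prec c d => ⟨7, ⟨encode c, encode d⟩⟩
  | Mu c => ⟨8, encode c⟩
  end.

Lemma encode_inj c d : encode c = encode d -> c = d.
Proof.
  assert (pair_inj : forall a b a' b', ⟨a, b⟩ = ⟨a', b'⟩ -> a = a' /\ b = b').
  { intros a b a' b' E. apply Cantor.to_nat_inj in E.
    split; [exact (f_equal fst E) | exact (f_equal snd E)]. }
  revert d; induction c; intros [] E; cbn [encode] in E;
    apply pair_inj in E; destruct E as [E1 E2]; try discriminate E1;
    try reflexivity; try (apply pair_inj in E2; destruct E2); f_equal; auto.
Qed.

(** [phi_oracle f e x y] is "φ_e^f(x) = y". A number that encodes no program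
    is an index of the nowhere defined functional. *)
Definition phi_oracle (f : nat -> nat) (e x y : nat) : Prop :=
  exists c, encode c = e /\ eval f c x y.

(** "φ_e(x) = y", where φ_e = φ_e^∅. *)
Definition phi (e x y : nat) : Prop := phi_oracle (fun _ => 0) e x y.

Definition halts_oracle (f : nat -> nat) (e x : nat) : Prop :=
  exists y, phi_oracle f e x y.

Definition Pi11 (C : Ensemble nat) : Prop :=
  exists e, forall n, In nat C n <-> forall f : nat -> nat, halts_oracle f e n.

(** * Lattices with underlying set [nat] *)

Definition is_sup (le : relation nat) (A : Ensemble nat) (s : nat) : Prop :=
  (forall x, In nat A x -> le x s) /\
  (forall u, (forall x, In nat A x -> le x u) -> le s u).

Definition is_inf (le : relation nat) (A : Ensemble nat) (i : nat) : Prop :=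
  (forall x, In nat A x -> le i x) /\
  (forall l, (forall x, In nat A x -> le l x) -> le l i).

Definition lattice_ordering (le : relation nat) : Prop :=
  order nat le /\
  (forall a b, exists s, is_sup le (Couple nat a b) s) /\
  (forall a b, exists i, is_inf le (Couple nat a b) i).

Definition complete (le : relation nat) : Prop :=
  forall A : Ensemble nat, (exists s, is_sup le A s) /\ (exists i, is_inf le A i).

(** "a ⪯ sup A" presupposes that the supremum exists, which is automatic in a
    complete lattice. *)
Definition compact (le : relation nat) (a : nat) : Prop :=
  forall (A : Ensemble nat) (s : nat), is_sup le A s -> le a s ->
  exists (A' : Ensemble nat) (s' : nat),
    Finite nat A' /\ Included nat A' A /\ is_sup le A' s' /\ le a s'.

Definition compactly_generated (le : relation nat) : Prop :=
  forall x, exists A : Ensemble nat,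
    (forall c, In nat A c -> compact le c) /\ is_sup le A x.

Definition algebraic (le : relation nat) : Prop :=
  complete le /\ compactly_generated le.

(** φ_e is total on codes of pairs, hence on [nat], as pairing is onto. *)
Definition char_function (e : nat) (R : relation nat) : Prop :=
  forall a b, (R a b /\ phi e ⟨a, b⟩ 1) \/ (~ R a b /\ phi e ⟨a, b⟩ 0).

Definition lattice_index (e : nat) (le : relation nat) : Prop :=
  lattice_ordering le /\ char_function e le.

Definition algebraic_lattice_indices : Ensemble nat :=
  fun e => exists le : relation nat, lattice_index e le /\ algebraic le.

(* Main.v *)
From Stdlib Require Import Arith Lia Ensembles Finite_sets Finite_sets_facts
  Relation_Definitions FunctionalExtensionality PropExtensionality
  Classical ClassicalEpsilon.
From Stdlib Require Cantor.
Require Import Defs.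

(** Over a lattice ordering of the natural numbers, algebraicity is a statement
    about subsets of [nat], which functions can name: every subset has a
    supremum and an infimum, and if [x] is not below [u], then some compact
    element is below [x] but not below [u]. Compactness of [c] is again a
    universal statement over subsets, and a finite subset of [A] may be replaced
    by an initial part [{x ∈ A | x < b}], which a number describes
    ([algebraic_order_iff]). Thus the definition has universal quantifiers over
    functions, quantifiers over numbers, and a matrix that is arithmetical in
    the ordering. The only obstacle to prenex form is a number quantifier in
    front of a function quantifier, as in the existence of a compact [c]; it
    moves inwards by countable choice, since
    [(exists m, forall g, R m g) <-> (forall w, exists m, R m (w m))], where [w]
    ranges over sequences of functions ([Pi11_rel_ex]).

    So the relations [P f n] of a function and a number that have the form
    [forall g, exists k, F (f ⊕ g) ⟨n, k⟩ = 0] with [F] computable are closed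
    under conjunction, disjunction, both number quantifiers and the universal
    function quantifier. In each case the oracle of the matrix is replaced by
    one that is computed from the new oracle and a parameter, which
    [eval_substitute] does on programs.

    The ordering enters through an index [n], so a definition of [phi] is
    needed as well. No universal program is required: [phi] is the least
    relation closed under the evaluation rules, and the intersection of all
    closed relations is a universal quantifier over functions in front of an
    arithmetical matrix ([phi_iff]). Finally, [n] is an index of an algebraic
    lattice iff [phi n] is total with values 0 and 1, and every function [r]
    either disagrees with some value of [phi n] or is the characteristic
    function of an algebraic lattice ordering ([algebraic_index_iff]). Passing
    through [r] makes the ordering and its negation equally simple, whereas the
    negation of the universal definition of [phi] would be existential over
    functions. *)

(** * Computable functionals *)

Definition first (n : nat) : nat := fst (Cantor.of_nat n).
Definition second (n : nat) : nat := snd (Cantor.of_nat n).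

Lemma first_pair a b : first ⟨a, b⟩ = a.
Proof. unfold first; now rewrite Cantor.cancel_of_to. Qed.

Lemma second_pair a b : second ⟨a, b⟩ = b.
Proof. unfold second; now rewrite Cantor.cancel_of_to. Qed.

Lemma pair_first_second n : ⟨first n, second n⟩ = n.
Proof.
  unfold first, second; rewrite <- surjective_pairing.
  apply Cantor.cancel_to_of.
Qed.

Definition computable (F : (nat -> nat) -> nat -> nat) : Prop :=
  exists c, forall f x, eval f c x (F f x).

Definition computable2 (F : (nat -> nat) -> nat -> nat -> nat) : Prop :=
  computable (fun f x => F f (first x) (second x)).

Lemma eval_first f x y : eval f Fst ⟨x, y⟩ x.
Proof. rewrite <- (first_pair x y) at 2; apply eval_Fst. Qed.

Lemma eval_second f x y : eval f Snd ⟨x, y⟩ y.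
Proof. rewrite <- (second_pair x y) at 2; apply eval_Snd. Qed.

(** Program [c] run with the oracle [z ↦ d ⟨p, z⟩]. The parameter [p] is the
    first component of the input and has to be carried through all
    subcomputations, so recursion and search pass from [⟨p, ⟨x, m⟩⟩] to
    [⟨⟨p, x⟩, m⟩] and back. *)
Fixpoint substitute (d c : code) : code :=
  match c with
  | Zero => Zero
  | Succ => Comp Succ Snd
  | Fst => Comp Fst Snd
  | Snd => Comp Snd Snd
  | Oracle => d
  | Pair a b => Pair (substitute d a) (substitute d b)
  | Comp a b => Comp (substitute d a) (Pair Fst (substitute d b))
  | Prec a b =>
      Comp (Prec (substitute d a)
              (Comp (substitute d b)
                 (Pair (Comp Fst Fst) (Pair (Comp Snd Fst) Snd))))
        (Pair (Pair Fst (Comp Fst Snd)) (Comp Snd Snd))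
  | Mu a =>
      Mu (Comp (substitute d a)
            (Pair (Comp Fst Fst) (Pair (Comp Snd Fst) Snd)))
  end.

Create HintDb evaldb.
#[local] Hint Resolve eval_first eval_second : evaldb.
#[local] Hint Constructors eval : evaldb.

Lemma eval_substitute f h d p c x y :
  (forall z, eval f d ⟨p, z⟩ (h z)) ->
  eval h c x y -> eval f (substitute d c) ⟨p, x⟩ y.
Proof.
  intros Hd H.
  assert (reassoc : forall u v w,
    eval f (Pair (Comp Fst Fst) (Pair (Comp Snd Fst) Snd)) ⟨⟨u, v⟩, w⟩
      ⟨u, ⟨v, w⟩⟩) by eauto with evaldb.
  assert (reassoc' : forall u v w,
    eval f (Pair (Pair Fst (Comp Fst Snd)) (Comp Snd Snd)) ⟨u, ⟨v, w⟩⟩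
      ⟨⟨u, v⟩, w⟩) by eauto 8 with evaldb.
  induction H; cbn [substitute]; eauto with evaldb.
  (* The step of [Prec]: the recursive value is only known through the outer
     rearrangement of the input, which has to be undone. *)
  inversion IHeval1 as [| | | | | | c' d' x' y' z' E1 E2 | | |]; subst.
  rewrite (eval_functional _ _ _ _ _ E1 (reassoc' p x n)) in E2.
  eauto with evaldb.
Qed.

Lemma computable_const k : computable (fun _ _ => k).
Proof.
  induction k as [| k [c Hc]].
  - exists Zero; constructor.
  - exists (Comp Succ c); eauto with evaldb.
Qed.

Lemma computable_id : computable (fun _ n => n).
Proof.
  exists (Pair Fst Snd); intros f n.
  rewrite <- (pair_first_second n) at 2.
  apply eval_Pair; [apply eval_Fst | apply eval_Snd].
Qed.

Lemma computable_comp F G :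
  computable F -> computable G -> computable (fun f n => F f (G f n)).
Proof.
  intros [c Hc] [d Hd]; exists (Comp c d); eauto with evaldb.
Qed.

Lemma computable_first G : computable G -> computable (fun f n => first (G f n)).
Proof. apply (computable_comp (fun _ n => first n)); exists Fst; constructor. Qed.

Lemma computable_second G : computable G -> computable (fun f n => second (G f n)).
Proof. apply (computable_comp (fun _ n => second n)); exists Snd; constructor. Qed.

Lemma computable_S G : computable G -> computable (fun f n => S (G f n)).
Proof. apply (computable_comp (fun _ n => S n)); exists Succ; constructor. Qed.

Lemma computable_oracle G : computable G -> computable (fun f n => f (G f n)).
Proof. apply (computable_comp (fun f n => f n)); exists Oracle; constructor. Qed.

Lemma computable_pair F G :
  computable F -> computable G -> computable (fun f n => ⟨F f n, G f n⟩).
Proof.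
  intros [c Hc] [d Hd]; exists (Pair c d); eauto with evaldb.
Qed.

(** The oracle that is substituted may depend on the input [n]. This uniformity
    is what allows a number quantifier to be moved past a function
    quantifier. *)
Lemma computable_subst F H G :
  computable F -> computable2 H -> computable G ->
  computable (fun f n => F (H f n) (G f n)).
Proof.
  intros [c Hc] [d Hd] [b Hb].
  exists (Comp (substitute d c) (Pair (Pair Fst Snd) b)); intros f n.
  apply (eval_Comp _ _ _ _ ⟨n, G f n⟩).
  - apply eval_Pair; [|apply Hb].
    rewrite <- (pair_first_second n) at 2; constructor; constructor.
  - apply (eval_substitute f (H f n)); [|apply Hc].
    intros z; specialize (Hd f ⟨n, z⟩).
    now rewrite first_pair, second_pair in Hd.
Qed.

(** Recursion on the value of [T], with a step that ignores the previous value.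
    It evaluates [F] also when [G] is selected, which is harmless as both are
    total. *)
Lemma computable_case T F G :
  computable T -> computable F -> computable G ->
  computable (fun f n => match T f n with 0 => F f n | S _ => G f n end).
Proof.
  intros [t Ht] [c Hc] [d Hd].
  exists (Comp (Prec c (Comp d Fst)) (Pair (Pair Fst Snd) t)); intros f n.
  apply (eval_Comp _ _ _ _ ⟨n, T f n⟩).
  - apply eval_Pair; [|apply Ht].
    rewrite <- (pair_first_second n) at 2; constructor; constructor.
  - induction (T f n) as [|m IH]; eauto with evaldb.
Qed.

Lemma computable_sub F G :
  computable F -> computable G -> computable (fun f n => F f n - G f n).
Proof.
  assert (Hpred : forall f n, eval f
    (Comp (Prec Zero (Comp Fst Snd)) (Pair Zero (Pair Fst Snd))) n (pred n)).
  { intros f n; apply (eval_Comp _ _ _ _ ⟨0, n⟩).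
    - apply eval_Pair; [constructor|].
      rewrite <- (pair_first_second n) at 2; constructor; constructor.
    - induction n as [|n IH]; cbn [pred]; eauto with evaldb. }
  intros [c Hc] [d Hd].
  exists (Comp (Prec c (Comp (Comp (Prec Zero (Comp Fst Snd))
                                (Pair Zero (Pair Fst Snd))) (Comp Snd Snd)))
            (Pair (Pair Fst Snd) d)); intros f n.
  apply (eval_Comp _ _ _ _ ⟨n, G f n⟩).
  - apply eval_Pair; [|apply Hd].
    rewrite <- (pair_first_second n) at 2; constructor; constructor.
  - induction (G f n) as [|m IH].
    + rewrite Nat.sub_0_r; eauto with evaldb.
    + apply (eval_Prec_S _ _ _ _ _ (F f n - m)); [assumption|].
      rewrite Nat.sub_succ_r; eauto with evaldb.
Qed.

(** * Pairing of oracles *)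

Definition lpart (h : nat -> nat) : nat -> nat := fun x => h ⟨0, x⟩.
Definition rpart (h : nat -> nat) : nat -> nat := fun x => h ⟨1, x⟩.
Definition join (f g : nat -> nat) : nat -> nat := fun n =>
  match first n with 0 => f (second n) | S _ => g (second n) end.

Lemma lpart_join f g : lpart (join f g) = f.
Proof.
  extensionality x; unfold lpart, join; now rewrite first_pair, second_pair.
Qed.

Lemma rpart_join f g : rpart (join f g) = g.
Proof.
  extensionality x; unfold rpart, join; now rewrite first_pair, second_pair.
Qed.

Lemma computable2_comp H A B :
  computable2 H -> computable A -> computable B ->
  computable (fun f n => H f (A f n) (B f n)).
Proof.
  intros HH HA HB.
  pose proof (computable_comp _ _ HH (computable_pair _ _ HA HB)) as C.
  cbv beta in C.
  replace (fun f n => H f (A f n) (B f n))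
    with (fun f n => H f (first ⟨A f n, B f n⟩) (second ⟨A f n, B f n⟩)).
  - exact C.
  - extensionality f; extensionality n; now rewrite first_pair, second_pair.
Qed.

(** Rules are selected by the shape of the goal: unification alone would unfold
    the pairing function into its recursive definition. *)
Ltac computability :=
  cbv beta delta [lpart rpart computable2];
  repeat first
    [ assumption
    | apply computable_const
    | apply computable_id
    | lazymatch goal with
      | |- computable (fun f n => S _) => apply computable_S
      | |- computable (fun f n => first _) => apply computable_first
      | |- computable (fun f n => second _) => apply computable_second
      | |- computable (fun f n => ⟨_, _⟩) => apply computable_pair
      | |- computable (fun f n => _ - _) => apply computable_sub
      | |- computable (fun f n => f _) => apply computable_oracle
      end ].

Lemma computable2_join H K :
  computable2 H -> computable2 K ->
  computable2 (fun f n => join (H f n) (K f n)).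
Proof.
  intros HH HK; unfold computable2, join.
  apply (computable_case (fun f x => first (second x))); [computability | |];
    (apply computable2_comp; [assumption | computability ..]).
Qed.

(** * Analytical relations of a function and a number *)

(** The function argument [f] collects the function variables that are free in
    a formula, and the number argument [n] the free number variables. *)
Definition Pi11_rel (P : (nat -> nat) -> nat -> Prop) : Prop :=
  exists F, computable F /\
    forall f n, P f n <-> forall g, exists k, F (join f g) ⟨n, k⟩ = 0.

Lemma Pi11_rel_ext P Q : (forall f n, Q f n <-> P f n) -> Pi11_rel P -> Pi11_rel Q.
Proof.
  intros E (F & HF & H); exists F; split; [assumption|].
  intros f n; now rewrite E, H.
Qed.

Lemma Pi11_rel_decidable F : computable F -> Pi11_rel (fun f n => F f n = 0).
Proof.
  intros HF.
  exists (fun h z => F (lpart h) (first z)); split.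
  - apply (computable_subst _ (fun h _ => lpart h)); computability.
  - intros f n; split.
    + intros E g; exists 0; now rewrite lpart_join, first_pair.
    + intros E; destruct (E f) as [k Ek].
      now rewrite lpart_join, first_pair in Ek.
Qed.

Lemma Pi11_rel_subst P H G :
  Pi11_rel P -> computable2 H -> computable G -> Pi11_rel (fun f n => P (H f n) (G f n)).
Proof.
  intros (F & HF & E) HH HG.
  exists (fun w z => F (join (H (lpart w) (first z)) (rpart w))
                      ⟨G (lpart w) (first z), second z⟩).
  split.
  - apply (computable_subst F (fun w z => join (H (lpart w) (first z)) (rpart w))
      (fun w z => ⟨G (lpart w) (first z), second z⟩)); trivial.
    + apply (computable2_join (fun w z => H (lpart w) (first z))
               (fun w z => rpart w)); [|computability].
      assert (HH' : computable2 (fun w => H (lpart w))).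
      { apply (computable_subst _ (fun w _ => lpart w) (fun _ z => z) HH);
          computability. }
      apply (computable2_comp (fun w => H (lpart w))
               (fun _ z => first (first z)) (fun _ z => second z));
        [assumption | computability ..].
    + apply computable_pair; [|computability].
      apply (computable_subst G (fun w _ => lpart w)); computability.
  - intros f n; rewrite E; split; intros C g; destruct (C g) as [k Ck];
      exists k; rewrite lpart_join, rpart_join, first_pair, second_pair in *;
      assumption.
Qed.

Lemma Pi11_rel_all_fun P :
  Pi11_rel (fun f n => P (lpart f) (rpart f) n) ->
  Pi11_rel (fun f n => forall g : nat -> nat, P f g n).
Proof.
  intros (F & HF & E).
  exists (fun v => F (join (join (lpart v) (lpart (rpart v))) (rpart (rpart v)))).
  split.
  - apply (computable_subst F (fun v _ =>
      join (join (lpart v) (lpart (rpart v))) (rpart (rpart v))) (fun _ z => z));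
      [assumption | | computability].
    apply (computable2_join (fun v _ => join (lpart v) (lpart (rpart v)))
      (fun v _ => rpart (rpart v))); [|computability].
    apply (computable2_join (fun v _ => lpart v) (fun v _ => lpart (rpart v)));
      computability.
  - assert (E' : forall f g n, P f g n <->
      forall g', exists k, F (join (join f g) g') ⟨n, k⟩ = 0).
    { intros f g n; now rewrite <- E, lpart_join, rpart_join. }
    intros f n; split.
    + intros H w; rewrite lpart_join, rpart_join; now apply E'.
    + intros H g; apply E'; intros g'; specialize (H (join g g')).
      now rewrite !lpart_join, !rpart_join, lpart_join in H.
Qed.

(** A universal number quantifier is absorbed by a function quantifier: [m] is
    the value [g 0] of an arbitrary function. *)
Lemma Pi11_rel_all P :
  Pi11_rel (fun f z => P f (first z) (second z)) ->
  Pi11_rel (fun f n => forall m : nat, P f n m).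
Proof.
  intros H.
  apply (Pi11_rel_ext (fun f n => forall g : nat -> nat, P f n (g 0))).
  - intros f n; split; intros C; [intros g; apply C|].
    intros m; exact (C (fun _ => m)).
  - apply (Pi11_rel_all_fun (fun f g n => P f n (g 0))).
    apply (Pi11_rel_subst _ (fun h _ => lpart h) (fun h n => ⟨n, rpart h 0⟩)) in H;
      [|computability ..].
    revert H; apply Pi11_rel_ext; intros h n; now rewrite first_pair, second_pair.
Qed.

(** A witness [g] refuting each [m] can be chosen for all [m] at once and coded
    as the sections of one function [w]. So [m] may be found after [w] is given,
    together with the [k] of the matrix, provided that [m] is then tested
    against the section [w ⟨m, _⟩] only. *)
Lemma Pi11_rel_ex P :
  Pi11_rel (fun f z => P f (first z) (second z)) ->
  Pi11_rel (fun f n => exists m : nat, P f n m).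
Proof.
  intros (F & HF & E).
  exists (fun w z =>
    F (join (lpart w) (fun y => rpart w ⟨first (second z), y⟩))
      ⟨⟨first z, first (second z)⟩, second (second z)⟩).
  split.
  - apply (computable_subst F
      (fun w z => join (lpart w) (fun y => rpart w ⟨first (second z), y⟩))
      (fun _ z => ⟨⟨first z, first (second z)⟩, second (second z)⟩));
      [assumption | | computability].
    apply (computable2_join (fun w _ => lpart w)
      (fun w z y => rpart w ⟨first (second z), y⟩)); computability.
  - assert (E' : forall f n m, P f n m <->
      forall g, exists k, F (join f g) ⟨⟨n, m⟩, k⟩ = 0).
    { intros f n m; now rewrite <- E, first_pair, second_pair. }
    intros f n; split.
    + intros [m Hm] w.
      destruct (proj1 (E' f n m) Hm (fun y => w ⟨m, y⟩)) as [k Hk].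
      exists ⟨m, k⟩.
      now rewrite lpart_join, rpart_join, !second_pair, !first_pair.
    + intros H; apply NNPP; intros C.
      assert (bad : forall m, exists g, forall k, F (join f g) ⟨⟨n, m⟩, k⟩ <> 0).
      { intros m; apply NNPP; intros D; apply C; exists m; apply E'.
        intros g; apply NNPP; intros D'; apply D; exists g; intros k Hk.
        apply D'; now exists k. }
      apply choice in bad; destruct bad as [b Hb].
      destruct (H (fun y => b (first y) (second y))) as [k Hk].
      apply (Hb (first (second ⟨n, k⟩)) (second (second ⟨n, k⟩))).
      rewrite <- Hk, lpart_join, rpart_join, first_pair, second_pair.
      do 2 f_equal. extensionality y. now rewrite first_pair, second_pair.
Qed.

(** Both connectives come from this one: a disjunction is an existential and a
    conjunction a universal quantification over the two cases. *)
Lemma Pi11_rel_case T P Q :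
  computable T -> Pi11_rel P -> Pi11_rel Q ->
  Pi11_rel (fun f n => match T f n with 0 => P f n | S _ => Q f n end).
Proof.
  intros HT (F & HF & EF) (G & HG & EG).
  exists (fun w z => match T (lpart w) (first z) with
                     | 0 => F w z | S _ => G w z end).
  split.
  - apply (computable_case (fun w z => T (lpart w) (first z))); trivial.
    apply (computable_subst T (fun w _ => lpart w)); computability.
  - intros f n.
    transitivity (forall g, exists k, match T f n with
      | 0 => F (join f g) ⟨n, k⟩ | S _ => G (join f g) ⟨n, k⟩ end = 0).
    + destruct (T f n); trivial.
    + split; intros H g; destruct (H g) as [k Hk]; exists k;
        rewrite lpart_join, first_pair in *; assumption.
Qed.

Lemma Pi11_rel_weaken P : Pi11_rel P -> Pi11_rel (fun f z => P f (first z)).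
Proof. intros H; apply (Pi11_rel_subst _ (fun f _ => f)); trivial; computability. Qed.

Lemma Pi11_rel_or P Q :
  Pi11_rel P -> Pi11_rel Q -> Pi11_rel (fun f n => P f n \/ Q f n).
Proof.
  intros HP HQ.
  apply (Pi11_rel_ext (fun f n => exists m, match m with 0 => P f n | S _ => Q f n end)).
  - intros f n; split.
    + intros [H | H]; [exists 0 | exists 1]; exact H.
    + intros [[|m] H]; auto.
  - apply Pi11_rel_ex; apply (Pi11_rel_case (fun _ z => second z));
      [computability | now apply Pi11_rel_weaken ..].
Qed.

Lemma Pi11_rel_and P Q :
  Pi11_rel P -> Pi11_rel Q -> Pi11_rel (fun f n => P f n /\ Q f n).
Proof.
  intros HP HQ.
  apply (Pi11_rel_ext (fun f n => forall m, match m with 0 => P f n | S _ => Q f n end)).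
  - intros f n; split.
    + intros [H H'] [|m]; assumption.
    + intros H; split; [exact (H 0) | exact (H 1)].
  - apply Pi11_rel_all; apply (Pi11_rel_case (fun _ z => second z));
      [computability | now apply Pi11_rel_weaken ..].
Qed.

(** Premises of implications have to be negated, so the relations with [Pi11_rel]
    complement are tracked separately; they contain the arithmetical ones. *)
Definition Delta11_rel (P : (nat -> nat) -> nat -> Prop) : Prop :=
  Pi11_rel P /\ Pi11_rel (fun f n => ~ P f n).

Lemma Pi11_rel_imp P Q :
  Delta11_rel P -> Pi11_rel Q -> Pi11_rel (fun f n => P f n -> Q f n).
Proof.
  intros [_ HP] HQ; apply (Pi11_rel_ext (fun f n => ~ P f n \/ Q f n)).
  - intros f n; split; [apply imply_to_or | tauto].
  - now apply Pi11_rel_or.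
Qed.

Lemma Delta11_rel_not P : Delta11_rel P -> Delta11_rel (fun f n => ~ P f n).
Proof.
  intros [H H']; split; [assumption|].
  apply (Pi11_rel_ext P); trivial; intros f n; split; [apply NNPP | auto].
Qed.

Lemma Delta11_rel_and P Q :
  Delta11_rel P -> Delta11_rel Q -> Delta11_rel (fun f n => P f n /\ Q f n).
Proof.
  intros [H H'] [K K']; split; [now apply Pi11_rel_and|].
  apply (Pi11_rel_ext (fun f n => ~ P f n \/ ~ Q f n)); [|now apply Pi11_rel_or].
  intros f n; split; [apply not_and_or | tauto].
Qed.

Lemma Delta11_rel_imp P Q :
  Delta11_rel P -> Delta11_rel Q -> Delta11_rel (fun f n => P f n -> Q f n).
Proof.
  intros HP HQ; split; [apply Pi11_rel_imp; trivial; apply HQ|].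
  apply (Pi11_rel_ext (fun f n => P f n /\ ~ Q f n)).
  - intros f n; split; [apply imply_to_and | tauto].
  - apply Pi11_rel_and; [apply HP | apply HQ].
Qed.

Lemma Delta11_rel_all P :
  Delta11_rel (fun f z => P f (first z) (second z)) ->
  Delta11_rel (fun f n => forall m : nat, P f n m).
Proof.
  intros [H H']; split; [now apply Pi11_rel_all|].
  apply (Pi11_rel_ext (fun f n => exists m, ~ P f n m)).
  - intros f n; split; [apply not_all_ex_not|].
    intros [m Hm] C; exact (Hm (C m)).
  - now apply Pi11_rel_ex.
Qed.

Lemma Delta11_rel_ex P :
  Delta11_rel (fun f z => P f (first z) (second z)) ->
  Delta11_rel (fun f n => exists m : nat, P f n m).
Proof.
  intros [H H']; split; [now apply Pi11_rel_ex|].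
  apply (Pi11_rel_ext (fun f n => forall m, ~ P f n m)).
  - intros f n; split; [apply not_ex_all_not|].
    intros C [m Hm]; exact (C m Hm).
  - now apply Pi11_rel_all.
Qed.

Lemma Delta11_rel_le F G :
  computable F -> computable G -> Delta11_rel (fun f n => F f n <= G f n).
Proof.
  intros HF HG; split.
  - apply (Pi11_rel_ext (fun f n => F f n - G f n = 0)); [lia|].
    apply Pi11_rel_decidable; computability.
  - apply (Pi11_rel_ext (fun f n => S (G f n) - F f n = 0)); [lia|].
    apply Pi11_rel_decidable; computability.
Qed.

Lemma Delta11_rel_eq F G :
  computable F -> computable G -> Delta11_rel (fun f n => F f n = G f n).
Proof.
  intros HF HG.
  replace (fun f n => F f n = G f n)
    with (fun f n => F f n <= G f n /\ G f n <= F f n).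
  - apply Delta11_rel_and; now apply Delta11_rel_le.
  - extensionality f; extensionality n; apply propositional_extensionality; lia.
Qed.

Lemma Pi11_rel_of_Delta11 P : Delta11_rel P -> Pi11_rel P.
Proof. now intros []. Qed.

Ltac delta11 :=
  cbv beta;
  lazymatch goal with
  | |- Delta11_rel (fun f n => _ /\ _) => apply Delta11_rel_and; delta11
  | |- Delta11_rel (fun f n => ~ _) => apply Delta11_rel_not; delta11
  | |- Delta11_rel (fun f n => forall _ : nat, _) => apply Delta11_rel_all; delta11
  | |- Delta11_rel (fun f n => exists _ : nat, _) => apply Delta11_rel_ex; delta11
  | |- Delta11_rel (fun f n => _ -> _) => apply Delta11_rel_imp; delta11
  | |- Delta11_rel (fun f n => _ = _) => apply Delta11_rel_eq; computability
  | |- Delta11_rel (fun f n => _ <= _) => apply Delta11_rel_le; computability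
  | |- Delta11_rel (fun f n => _ < _) => apply Delta11_rel_le; computability
  | |- _ => idtac
  end.

Ltac pi11 :=
  cbv beta;
  first
  [ assumption
  | apply Pi11_rel_of_Delta11; solve [delta11]
  | lazymatch goal with
    | |- Pi11_rel (fun f n => _ /\ _) => apply Pi11_rel_and; pi11
    | |- Pi11_rel (fun f n => _ \/ _) => apply Pi11_rel_or; pi11
    | |- Pi11_rel (fun f n => forall _ : nat, _) => apply Pi11_rel_all; pi11
    | |- Pi11_rel (fun f n => exists _ : nat, _) => apply Pi11_rel_ex; pi11
    | |- Pi11_rel (fun f n => forall _ : nat -> nat, _) =>
        apply Pi11_rel_all_fun; pi11
    | |- Pi11_rel (fun f n => _ -> _) => apply Pi11_rel_imp; [solve [delta11] | pi11]
    | |- _ => idtac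
    end ].

(** A computable matrix becomes a program by unbounded search for [k]. *)
Lemma Pi11_of_rel C : Pi11_rel (fun _ => C) -> Pi11 C.
Proof.
  intros (F & HF & E).
  assert (HG : computable (fun g => F (join (fun _ => 0) g))).
  { apply (computable_subst F (fun g _ => join (fun _ => 0) g) (fun _ z => z));
      [assumption | | computability].
    apply (computable2_join (fun _ _ _ => 0) (fun g _ => g)); computability. }
  destruct HG as [c Hc].
  exists (encode (Mu c)); intros n; unfold In; rewrite (E (fun _ => 0)).
  split; intros H g; specialize (H g).
  - assert (L : exists k, F (join (fun _ => 0) g) ⟨n, k⟩ = 0 /\
                  forall m, m < k -> F (join (fun _ => 0) g) ⟨n, m⟩ <> 0).
    { destruct H as [k Hk]; revert Hk.
      induction k as [k IH] using lt_wf_ind; intros Hk.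
      destruct (classic (exists m, m < k /\ F (join (fun _ => 0) g) ⟨n, m⟩ = 0))
        as [(m & Lm & Hm) | N]; [exact (IH m Lm Hm)|].
      exists k; split; [assumption|]; intros m Lm Hm; apply N; now exists m. }
    destruct L as (k & Hk & Lk).
    exists k, (Mu c); split; [reflexivity|].
    apply (eval_Mu g c n k (fun m => pred (F (join (fun _ => 0) g) ⟨n, m⟩))).
    + rewrite <- Hk; apply Hc.
    + intros m Lm; rewrite Nat.succ_pred; auto.
  - destruct H as (k & d & Ed & H).
    apply encode_inj in Ed; subst d.
    exists k; inversion H; subst.
    eapply eval_functional; [apply Hc | eassumption].
Qed.

(** * An inductive definition of program evaluation *)

Definition zeros (f : nat -> nat) : Ensemble nat := fun x => f x = 0.

Lemma exists_zeros (A : Ensemble nat) : exists f, forall x, f x = 0 <-> In nat A x.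
Proof.
  exists (fun x => if excluded_middle_informative (In nat A x) then 0 else 1).
  intros x; destruct excluded_middle_informative; split; (easy || lia).
Qed.

(** Closure under the clauses of [eval] (with the zero oracle) on encoded
    programs. Quantifiers range over all numbers, and the base clause of [Prec]
    does not evaluate [d], so that without a further premise the least closed
    relation would also run [⟨7, ⟨c, d⟩⟩] for a number [d] that encodes no
    program. The predicate [K], closed under the formation of programs, excludes
    this. *)
Definition eval_closed (K : nat -> Prop) (E : nat -> nat -> nat -> Prop) : Prop :=
  (forall t, t <= 4 -> K ⟨t, 0⟩) /\
  (forall t c d, 5 <= t -> t <= 7 -> K c -> K d -> K ⟨t, ⟨c, d⟩⟩) /\
  (forall c, K c -> K ⟨8, c⟩) /\
  (forall x, E ⟨0, 0⟩ x 0) /\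
  (forall x, E ⟨1, 0⟩ x (S x)) /\
  (forall x, E ⟨2, 0⟩ x (first x)) /\
  (forall x, E ⟨3, 0⟩ x (second x)) /\
  (forall x, E ⟨4, 0⟩ x 0) /\
  (forall c d x y z, E c x y -> E d x z -> E ⟨5, ⟨c, d⟩⟩ x ⟨y, z⟩) /\
  (forall c d x y z, E d x y -> E c y z -> E ⟨6, ⟨c, d⟩⟩ x z) /\
  (forall c d x y, K d -> E c x y -> E ⟨7, ⟨c, d⟩⟩ ⟨x, 0⟩ y) /\
  (forall c d x n y z, E ⟨7, ⟨c, d⟩⟩ ⟨x, n⟩ y -> E d ⟨x, ⟨n, y⟩⟩ z ->
     E ⟨7, ⟨c, d⟩⟩ ⟨x, S n⟩ z) /\
  (forall c x n, E c ⟨x, n⟩ 0 ->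
     (forall m, m < n -> exists k, E c ⟨x, m⟩ (S k)) -> E ⟨8, c⟩ x n).

Lemma eval_closed_phi : eval_closed (fun e => exists c, encode c = e) phi.
Proof.
  unfold eval_closed, phi, phi_oracle; repeat split.
  - intros t Ht.
    do 5 (destruct t as [|t];
      [(now exists Zero) || (now exists Succ) || (now exists Fst) ||
       (now exists Snd) || (now exists Oracle)|]).
    lia.
  - intros t c d L L' [c' <-] [d' <-].
    assert (Ht : t = 5 \/ t = 6 \/ t = 7) by lia.
    destruct Ht as [-> | [-> | ->]];
      [now exists (Pair c' d') | now exists (Comp c' d') | now exists (Prec c' d')].
  - intros c [c' <-]; now exists (Mu c').
  - intros x; exists Zero; split; constructor.
  - intros x; exists Succ; split; constructor.
  - intros x; exists Fst; split; constructor.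
  - intros x; exists Snd; split; constructor.
  - intros x; exists Oracle; split; [|apply (eval_Oracle (fun _ => 0))]; reflexivity.
  - intros c d x y z (c' & <- & Hc) (d' & <- & Hd).
    exists (Pair c' d'); split; [reflexivity | now constructor].
  - intros c d x y z (d' & <- & Hd) (c' & <- & Hc).
    exists (Comp c' d'); split; [reflexivity | now apply (eval_Comp _ _ _ _ y)].
  - intros c d x y (d' & <-) (c' & <- & Hc).
    exists (Prec c' d'); split; [reflexivity | now constructor].
  - intros c d x n y z (e & Ee & He) (d' & <- & Hd).
    destruct e as [| | | | | | | c' e' |]; cbn [encode] in Ee;
      apply Cantor.to_nat_inj in Ee; try discriminate Ee.
    apply (f_equal snd) in Ee; cbn [snd] in Ee; apply Cantor.to_nat_inj in Ee.
    injection Ee as <- Ee; apply encode_inj in Ee; subst e'.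
    exists (Prec c' d'); split; [reflexivity | now apply (eval_Prec_S _ _ _ _ _ y)].
  - intros c x n (c' & <- & Hc) Hm.
    exists (Mu c'); split; [reflexivity|].
    assert (G : forall m, exists k, m < n -> eval (fun _ => 0) c' ⟨x, m⟩ (S k)).
    { intros m; destruct (classic (m < n)) as [L | L]; [|now exists 0].
      destruct (Hm m L) as (k & d & Ed & Hd).
      apply encode_inj in Ed; subst d; now exists k. }
    apply choice in G; destruct G as [g Hg].
    now apply (eval_Mu _ _ _ _ g).
Qed.

Lemma eval_closed_least K E c x y :
  eval_closed K E -> eval (fun _ => 0) c x y -> E (encode c) x y.
Proof.
  intros (K0 & K2 & K1 & E0 & E1 & E2 & E3 & E4 & E5 & E6 & E7 & E7' & E8) H.
  assert (HK : forall d, K (encode d)).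
  { induction d; cbn [encode];
      first [apply K0; lia | apply K2; trivial; lia | now apply K1]. }
  induction H; cbn [encode]; auto.
  - apply (E6 _ _ _ y); trivial.
  - apply (E7' _ _ _ _ y); trivial.
  - apply E8; [assumption|]; intros m L; exists (g m); auto.
Qed.

(** [phi] itself is closed, and it is contained in every closed relation; hence
    it is their intersection. *)
Lemma phi_iff e x y :
  phi e x y <->
  forall h : nat -> nat,
    eval_closed (fun c => lpart h c = 0)
      (fun e x y => rpart h ⟨e, ⟨x, y⟩⟩ = 0) -> rpart h ⟨e, ⟨x, y⟩⟩ = 0.
Proof.
  split.
  - intros (c & <- & H) h C; exact (eval_closed_least _ _ c x y C H).
  - intros H.
    destruct (exists_zeros (fun e => exists c, encode c = e)) as [k Hk].
    destruct (exists_zeros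
      (fun p => phi (first p) (first (second p)) (second (second p)))) as [g Hg].
    specialize (H (join k g)); rewrite lpart_join, rpart_join in H.
    assert (P : forall e x y, (g ⟨e, ⟨x, y⟩⟩ = 0) = phi e x y).
    { intros e' x' y'; apply propositional_extensionality; rewrite Hg.
      unfold In; now rewrite !second_pair, !first_pair. }
    rewrite P in H; apply H.
    replace (fun c => k c = 0) with (fun e => exists c, encode c = e).
    + replace (fun e x y => g ⟨e, ⟨x, y⟩⟩ = 0) with phi; [apply eval_closed_phi|].
      extensionality e'; extensionality x'; extensionality y'; now rewrite P.
    + extensionality c; apply propositional_extensionality; now rewrite Hk.
Qed.

Lemma Pi11_rel_phi A B C :
  computable A -> computable B -> computable C ->
  Pi11_rel (fun f n => phi (A f n) (B f n) (C f n)).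
Proof.
  intros HA HB HC.
  assert (H : Pi11_rel (fun _ p => phi (first p) (first (second p)) (second (second p)))).
  { eapply Pi11_rel_ext; [intros f n; apply phi_iff|].
    unfold eval_closed; pi11. }
  apply (Pi11_rel_subst _ (fun f _ => f) (fun f n => ⟨A f n, ⟨B f n, C f n⟩⟩)) in H;
    [|computability ..].
  revert H; apply Pi11_rel_ext; intros f n; now rewrite !second_pair, !first_pair.
Qed.

(** * Algebraic lattices by quantification over functions *)

Lemma complete_iff le :
  complete le <->
  forall f, (exists s, is_sup le (zeros f) s) /\ (exists i, is_inf le (zeros f) i).
Proof.
  split; [intros H f; apply H|].
  intros H A; destruct (exists_zeros A) as [f Hf].
  assert (E : A = zeros f).
  { extensionality x; apply propositional_extensionality; now rewrite (Hf x). }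
  rewrite E; apply H.
Qed.

Definition compact_below_bound (le : relation nat) (a : nat) : Prop :=
  forall (f : nat -> nat) (s : nat), is_sup le (zeros f) s -> le a s ->
  exists b s', is_sup le (fun x => f x = 0 /\ x < b) s' /\ le a s'.

Lemma bounded_finite b (A : Ensemble nat) :
  (forall x, In nat A x -> x < b) -> Finite nat A.
Proof.
  intros H; apply (Finite_downward_closed _ (fun x => x < b)); [|exact H].
  clear A H; induction b as [|b IH].
  - replace (fun x => x < 0) with (Empty_set nat); [constructor|].
    extensionality x; apply propositional_extensionality; split; [easy | lia].
  - replace (fun x => x < S b) with (Add nat (fun x => x < b) b).
    + now apply Add_preserves_Finite.
    + extensionality x; apply propositional_extensionality; split.
      * intros [y L | y []]; [unfold In in L|]; lia.
      * intros L; destruct (Nat.eq_dec x b) as [-> | N];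
          [right; constructor | left; unfold In; lia].
Qed.

Lemma finite_bounded (A : Ensemble nat) :
  Finite nat A -> exists b, forall x, In nat A x -> x < b.
Proof.
  induction 1 as [| A _ [b Hb] y _]; [now exists 0|].
  exists (b + S y); intros x [x' L | x' []]; [apply Hb in L|]; lia.
Qed.

(** A finite subset is contained in some initial part of the set, which is
    again finite but is named by a single number. The enlargement keeps [a]
    below the supremum, which exists by completeness. *)
Lemma compact_iff le a :
  transitive nat le -> complete le -> compact le a <-> compact_below_bound le a.
Proof.
  intros Tr Co; split.
  - intros H f s Hs L; destruct (H _ _ Hs L) as (A & t & Fin & Inc & Ht & Lt).
    destruct (finite_bounded A Fin) as [b Hb].
    destruct (Co (fun x => f x = 0 /\ x < b)) as [[s' Hs'] _].
    exists b, s'; split; [assumption|]; apply (Tr _ t); [assumption|].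
    apply Ht; intros x Hx; apply Hs'; split; [exact (Inc x Hx) | exact (Hb x Hx)].
  - intros H A s Hs L; destruct (exists_zeros A) as [f Hf].
    assert (E : zeros f = A).
    { extensionality x; apply propositional_extensionality; apply (Hf x). }
    rewrite <- E in Hs; destruct (H f s Hs L) as (b & s' & Hs' & L').
    exists (fun x => f x = 0 /\ x < b), s'; repeat split; trivial.
    + apply (bounded_finite b); now intros x [].
    + intros x [Hx _]; now apply Hf.
    + apply Hs'.
    + apply Hs'.
Qed.

(** The best candidate for a set of compact elements with supremum [x] consists
    of all compact elements below [x]. It has supremum [x] unless some upper
    bound [u] of it is not above [x]. The right-hand side turns compactness,
    which is a universal statement over functions, into a positive
    occurrence. *)
Lemma compactly_generated_iff le :
  compactly_generated le <->
  forall x u, le x u \/ exists c, compact le c /\ le c x /\ ~ le c u.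
Proof.
  split.
  - intros H x u; destruct (H x) as (A & HA & [Ub Lub]).
    destruct (classic (le x u)) as [L | L]; [now left | right].
    apply NNPP; intros N; apply L, Lub; intros c Hc.
    apply NNPP; intros N'; apply N; exists c; auto.
  - intros H x; exists (fun c => compact le c /\ le c x); split; [now intros c []|].
    split; [now intros c []|]; intros u Hu.
    destruct (H x u) as [L | (c & Cc & L & N)]; [assumption|].
    destruct N; apply Hu; now split.
Qed.

(** The lattice operations are contained in completeness, as suprema and infima
    of couples. *)
Definition algebraic_order (le : relation nat) : Prop :=
  (forall a, le a a) /\
  (forall a b c, le a b -> le b c -> le a c) /\
  (forall a b, le a b -> le b a -> a = b) /\
  (forall f, (exists s, is_sup le (zeros f) s) /\ (exists i, is_inf le (zeros f) i)) /\
  (forall x u, le x u \/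
     exists c, compact_below_bound le c /\ le c x /\ ~ le c u).

Lemma algebraic_order_iff le :
  algebraic_order le <-> lattice_ordering le /\ algebraic le.
Proof.
  split.
  - intros (Re & Tr & An & Co & Ge); apply complete_iff in Co.
    repeat split; trivial.
    + intros a b; apply Co.
    + intros a b; apply Co.
    + apply Co.
    + apply Co.
    + apply compactly_generated_iff; intros x u.
      destruct (Ge x u) as [L | (c & Cc & L)]; [now left | right].
      exists c; split; [now apply compact_iff | assumption].
  - intros (([Re Tr An] & _) & Co & Ge).
    split; [exact Re | split; [exact Tr | split; [exact An|]]].
    split; [now apply complete_iff|]; intros x u.
    destruct (proj1 (compactly_generated_iff le) Ge x u) as [L | (c & Cc & L)];
      [now left | right].
    exists c; split; [now apply compact_iff | assumption].
Qed.

Lemma phi_functional e x y z : phi e x y -> phi e x z -> y = z.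
Proof.
  intros (c & Ec & Hc) (d & Ed & Hd); rewrite <- Ed in Ec.
  apply encode_inj in Ec; subst d; exact (eval_functional _ _ _ _ _ Hc Hd).
Qed.

(** If [phi n] is total, it is the only function [r] that refutes the first
    alternative, so that the second one speaks of [phi n]. *)
Lemma algebraic_index_iff n :
  algebraic_lattice_indices n <->
  (forall p, phi n p 0 \/ phi n p 1) /\
  forall r : nat -> nat,
    (exists p y, phi n p y /\ r p <> y) \/
    algebraic_order (fun a b => r ⟨a, b⟩ = 1).
Proof.
  split.
  - intros (le & (La & Ch) & Al); split.
    + intros p; rewrite <- (pair_first_second p).
      destruct (Ch (first p) (second p)) as [[_ H] | [_ H]]; auto.
    + intros r; apply NNPP; intros N; apply not_or_and in N; destruct N as [N N'].
      apply N'; replace (fun a b => r ⟨a, b⟩ = 1) with le;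
        [now apply algebraic_order_iff|].
      assert (Hr : forall p y, phi n p y -> r p = y).
      { intros p y H; apply NNPP; intros D; apply N; now exists p, y. }
      extensionality a; extensionality b; apply propositional_extensionality.
      destruct (Ch a b) as [[L H] | [L H]]; apply Hr in H; rewrite H; easy.
  - intros [Tot H].
    assert (R : forall p, exists y, phi n p y).
    { intros p; destruct (Tot p); eauto. }
    apply choice in R; destruct R as [r Hr].
    destruct (H r) as [(p & y & Hy & N) | Al].
    { destruct N; exact (phi_functional _ _ _ _ (Hr p) Hy). }
    destruct (proj1 (algebraic_order_iff _) Al) as [La Al'].
    exists (fun a b => r ⟨a, b⟩ = 1); split; [split; [exact La|] | exact Al'].
    intros a b.
    destruct (Tot ⟨a, b⟩) as [T | T];
      rewrite (phi_functional _ _ _ _ (Hr ⟨a, b⟩) T); [right | left]; auto.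
Qed.

Theorem lemma2p12 : Pi11 algebraic_lattice_indices.
Proof.
  apply Pi11_of_rel.
  eapply Pi11_rel_ext; [intros f n; apply algebraic_index_iff|].
  unfold algebraic_order, compact_below_bound, is_sup, is_inf, zeros, In.
  apply Pi11_rel_and;
    [apply Pi11_rel_all, Pi11_rel_or; apply Pi11_rel_phi; computability|].
  apply Pi11_rel_all_fun, Pi11_rel_or.
  - apply Pi11_rel_ex, Pi11_rel_ex, Pi11_rel_and;
      [apply Pi11_rel_phi; computability | pi11].
  - pi11.
Qed.
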